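(* Suppose the system is locally $1$-step reachable: there exists $\gamma>0$ such that for every $x\in\mathcal{X}_\gamma:=\{x\in\mathcal{X}:\|x-x_F\|\le\gamma\}$ there exists $u_x^{\mathrm{one}}\in\mathcal{U}$ with $f(x,u_x^{\mathrm{one}})=x_F$. Let the stage cost be $r(x,u)=r_x(x)+r_u(u)$, where $r_x,r_u$ are continuous functions satisfying $r_x(x_F)=0$, $r_x(x)>0$ for all $x\in\mathcal{X}\setminus\{x_F\}$, $r_u(0)=0$, and $r_u(u)>0$ for all $u\in\mathcal{U}\setminus\{0\}$. Assume: (i) There exists $c>0$ such that $\mathcal{X}_c:=\{x\in\mathcal{X}:\|x-x_F\|\le c\}\subset\mathcal{Q}$, where $$\mathcal{Q}:=\{x\in\mathcal{X}_\gamma:\ \exists\, u_x^{\mathrm{one}}\in\mathcal{U}\text{ such that } f(x,u_x^{\mathrm{one}})=x_F\text{ and } r_x(f(x,u))+r_u(u)\ge r_u(u_x^{\mathrm{one}})\ \ \forall u\in\mathcal{U}\}.$$ (ii) There exists a class $\mathcal{K}$ function $\mathfrak{r}$ such that $r_x(x)\ge\mathfrak{r}(\|x-x_F\|)$ for all $x\notin\mathcal{Q}$. Assume that $f$ is continuous on $\mathcal{Q}\times\mathcal{U}$. Then, for any $j\ge1$, the function $\mathcal{J}^j:=\mathcal{J}_{(\mathcal{S}^j,\mathcal{D}^j)}$ is continuous at $x_F$, where $\mathcal{J}_{(\mathcal{S}^j,\mathcal{D}^j)}$ is the optimal value function of the distributionally robust finite-horizon problem (see context) with the sampled-safe-set $\mathcal{S}^j$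 and ambiguity set $\mathcal{D}^j$ obtained at the end of iteration $j$ of the DR-RC-Iterative-MPC procedure.
   Context: Notation: $\mathbb{N}=\{0,1,2,\dots\}$, $[z]_+=\max(z,0)$, $\|\cdot\|$ is the Euclidean norm. A class $\mathcal{K}$ function is a continuous strictly increasing $\alpha:[0,\infty)\to[0,\infty)$ with $\alpha(0)=0$. For a random variable $Z$ with distribution $\mu$ and $\beta\in(0,1)$, $\mathrm{CVaR}_\beta^{\mu}[Z]=\inf_{s\in\mathbb{R}}\{s+\beta^{-1}\mathbb{E}^{\mu}[Z-s]_+\}$. Problem data. The system is $x_{t+1}=f(x_t,u_t)$ with $f:\mathbb{R}^{n_x}\times\mathbb{R}^{n_u}\to\mathbb{R}^{n_x}$; states and inputs are constrained to compact sets $\mathcal{X}\subset\mathbb{R}^{n_x}$, $\mathcal{U}\subset\mathbb{R}^{n_u}$. $x_S\in\mathcal{X}$ is the initial state and $x_F\in\mathcal{X}$ the target equilibrium point (the system stays at $x_F$ under zero input). The stage cost is $r:\mathcal{X}\times\mathcal{U}\to[0,\infty)$. $w$ is a random variable with distribution $\mathbb{P}$ supported on a compact set $\mathcal{W}\subset\mathbb{R}^{n_w}$; $g:\mathcal{X}\times\mathcal{W}\to\mathbb{R}$ is continuous; $\delta>0$, $\beta\in(0,1)$ and the horizon $K\in\mathbb{N}$, $K\ge1$, are given. Ambiguity sets. $\mathbb{D}$ is a map assigning to each finite dataset of samples from $\mathcal{W}$ a closed nonempty set of probability distributions supported on $\mathcal{W}$, such that for i.i.d. samples from $\mathbb{P}$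 this set contains $\mathbb{P}$ with probability at least a given $\zeta\in(0,1)$. With $\widehat{\mathcal{W}}^{j}$ the dataset of i.i.d. samples of $w$ available at the end of iteration $j$ ($\widehat{\mathcal{W}}^{0}$ is given initially, and one sample per time-step is added during each iteration), $\mathcal{D}^{j}=\mathbb{D}(\widehat{\mathcal{W}}^{j})$. Sampled-safe-sets. A sampled-safe-set is a set $\mathcal{S}\subset\mathbb{N}\times\mathcal{X}\times[0,\infty)$ of triples (trajectory index $i$, state $x$, cost-to-go $J$). $\Pi_{\mathrm{state}}(\mathcal{S})$ is the set of states appearing in it. Its minimum cost-to-go is $Q_{\mathcal{S}}(x)=\min\{J:(i,x,J)\in\mathcal{S}\}$ for $x\in\Pi_{\mathrm{state}}(\mathcal{S})$, and $+\infty$ otherwise. Finite-horizon problem. For a state $x\in\mathcal{X}$, sampled-safe-set $\overline{\mathcal{S}}$ and ambiguity set $\overline{\mathcal{D}}$, $\mathrm{FH}(x;\overline{\mathcal{S}},\overline{\mathcal{D}})$ is: minimize $\sum_{k=0}^{K-1}r(x_k,u_k)+Q_{\overline{\mathcal{S}}}(x_K)$ over $(x_0,\dots,x_K)$, $(u_0,\dots,u_{K-1})$ subject to $x_0=x$; $x_{k+1}=f(x_k,u_k)$, $x_k\in\mathcal{X}$, $u_k\in\mathcal{U}$, $\sup_{\mu\in\overline{\mathcal{D}}}\mathrm{CVaR}_\beta^{\mu}[g(x_k,w)]\le\delta$ for all $k=0,\dots,K-1$; and $x_K\in\Pi_{\mathrm{state}}(\overline{\mathcal{S}})$. Its minimum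 value is denoted $\mathcal{J}_{(\overline{\mathcal{S}},\overline{\mathcal{D}})}(x)$, and $\mathcal{J}_{(\overline{\mathcal{S}},\overline{\mathcal{D}})}$ is regarded as a function $\mathcal{X}\to[0,\infty)$. Routine $\mathrm{DR\_MPC}(\overline{\mathcal{S}},\overline{\mathcal{D}})$: start with $t=0$, $x_0=x_S$. While $x_t\ne x_F$: solve $\mathrm{FH}(x_t;\overline{\mathcal{S}},\overline{\mathcal{D}})$, let $u_t$ be the first input of an optimizer, set $x_{t+1}=f(x_t,u_t)$, and increase $t$ by one. Return the state and input sequences. After $x_F$ is reached, the state stays at $x_F$ with zero input. DR-RC-Iterative-MPC: for $j=1,2,\dots$: (1) $(\mathsf{x}^j,\mathsf{u}^j)=\mathrm{DR\_MPC}(\mathcal{S}^{j-1},\mathcal{D}^{j-1})$, with states $x_t^j$, inputs $u_t^j$ and length $T_j$; (2) $\widehat{\mathcal{W}}^{j}$ is $\widehat{\mathcal{W}}^{j-1}$ with the $T_j$ new samples added, and $\mathcal{D}^j=\mathbb{D}(\widehat{\mathcal{W}}^j)$; (3) form $\tilde{\mathcal{S}}=\mathcal{S}^{j-1}\cup\{(j,x_t^j,J^j_{(t:\infty)})\}_{t=1}^{T_j}$, where $J^j_{(t:\infty)}=\sum_{k=t}^{\infty}r(x_k^j,u_k^j)$; (4) $\mathcal{S}^j$ is obtained from $\tilde{\mathcal{S}}$ by deleting all triples of every trajectory index $i$ for which some $(i,x,J)\in\tilde{\mathcal{S}}$ has $\sup_{\mu\in\mathcal{D}^j}\mathrm{CVaR}_\beta^{\mu}[g(x,w)]>\delta$.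 Standing assumption: the trajectories are of finite length, ending at $x_F$. Initialization (standing assumption): $\mathcal{S}^0$ contains the states (with trajectory index $0$ and their costs-to-go) of a finite-length trajectory of the system, generated by inputs in $\mathcal{U}$, that starts at $x_S$ and reaches $x_F$ and is robustly safe: $x\in\mathcal{X}$ and $g(x,w)\le\delta$ for all $w\in\mathcal{W}$ and all $x\in\Pi_{\mathrm{state}}(\mathcal{S}^0)$. *)

(* Defs.v *)
From HB Require Import structures.
From mathcomp Require Import all_boot all_order all_algebra.
From mathcomp Require Import all_classical all_reals all_analysis.

Set Implicit Arguments.
Unset Strict Implicit.
Unset Printing Implicit Defensive.

Import Order.TTheory GRing.Theory Num.Theory.
Import numFieldNormedType.Exports.

Local Open Scope classical_set_scope.
Local Open Scope ring_scope.

(* The norm `|v| of the library on row vectors is the sup norm; the Euclidean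
   one induces the same topology. *)
Definition enorm (R : realType) (n : nat) (v : 'rV[R]_n) : R :=
  Num.sqrt (\sum_i v ord0 i ^+ 2).

Definition class_K (R : realType) (a : R -> R) : Prop :=
  [/\ {within `[0, +oo[, continuous a},
      {in `[0, +oo[ &, {homo a : s t / s < t}} &
      a 0 = 0].

(* R^n with its Borel sigma-algebra *)
Definition borelRn (R : realType) (n : nat) :=
  g_sigma_algebraType (@open 'rV[R]_n).

(* Z only needs to make sense on A, where mu is meant to be supported. *)
Definition cvar d (T : measurableType d) (R : realType) (beta : R)
    (mu : probability T R) (A : set T) (Z : T -> R) : \bar R :=
  ereal_inf [set (s%:E + beta^-1%:E *
                    \int[mu]_(w in A) (Num.max (Z w - s) 0)%:E)%E | s in [set: R]].

Definition weak_cvg (R : realType) (n : nat)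
    (mu_ : nat -> probability (borelRn R n) R) (mu : probability (borelRn R n) R) :=
  forall h : 'rV[R]_n -> R, continuous h -> (exists M, forall w, `|h w| <= M) ->
    (\int[mu_ k]_w (h w)%:E)%E @[k --> \oo] --> (\int[mu]_w (h w)%:E)%E.

(* Sequential closedness: the weak topology on probabilities over R^n is
   metrizable. *)
Definition weakly_closed (R : realType) (n : nat)
    (D : set (probability (borelRn R n) R)) :=
  forall mu_ mu, (forall k, D (mu_ k)) -> weak_cvg mu_ mu -> D mu.

Definition iid d (Omega : measurableType d) (R : realType)
    (Pr : probability Omega R) (n : nat) (P : probability (borelRn R n) R)
    (xi : nat -> {RV Pr >-> borelRn R n}) : Prop :=
  (forall k A, measurable A -> Pr (xi k @^-1` A) = P A) /\
  (forall N (A : nat -> set (borelRn R n)), (forall k, measurable (A k)) ->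
    Pr (\bigcap_(k in `I_N) (xi k @^-1` A k)) =
    (\prod_(k < N) Pr (xi k @^-1` A k))%E).

(* The event "P belongs to the ambiguity set" need not be measurable, hence the
   measurable lower bound E. *)
Definition ambiguity_map d (Omega : measurableType d) (R : realType)
    (Pr : probability Omega R) (n : nat) (P : probability (borelRn R n) R)
    (xi : nat -> {RV Pr >-> borelRn R n}) (W : set (borelRn R n)) (zeta : R)
    (DD : seq (borelRn R n) -> set (probability (borelRn R n) R)) : Prop :=
  (forall s, (forall w, w \in s -> W w) ->
     [/\ DD s !=set0, forall mu, DD s mu -> mu W = 1%E & weakly_closed (DD s)]) /\
  (forall N, (0 < N)%N ->
     exists E, [/\ measurable E,
       forall om, E om -> DD (mkseq (fun k => xi k om) N) P &
       (zeta%:E <= Pr E)%E]).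

Record mpc_data (R : realType) (nx nu nw : nat) := MpcData {
  dyn : 'rV[R]_nx -> 'rV[R]_nu -> 'rV[R]_nx ;          (* f *)
  states : set 'rV[R]_nx ;                             (* calligraphic X *)
  inputs : set 'rV[R]_nu ;                             (* calligraphic U *)
  start : 'rV[R]_nx ;                                  (* x_S *)
  target : 'rV[R]_nx ;                                 (* x_F *)
  stage_cost : 'rV[R]_nx -> 'rV[R]_nu -> R ;           (* r *)
  noises : set (borelRn R nw) ;                        (* calligraphic W *)
  risk_fun : 'rV[R]_nx -> 'rV[R]_nw -> R ;             (* g *)
  risk_bound : R ;                                     (* delta *)
  risk_level : R ;                                     (* beta *)
  horizon : nat                                        (* K *)
}.

(* Triples (trajectory index, state, cost-to-go) *)
Definition safe_set (R : realType) (nx : nat) := set (nat * 'rV[R]_nx * R).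

Definition sampled_safe_set (R : realType) (nx nu nw : nat)
    (p : mpc_data R nx nu nw) (S : safe_set R nx) : Prop :=
  forall i x J, S (i, x, J) -> states p x /\ 0 <= J.

Definition Pi_state (R : realType) (nx : nat) (S : safe_set R nx) : set 'rV[R]_nx :=
  [set x | exists i J, S (i, x, J)].

(* The infimum is +oo off Pi_state S, and a minimum when S is finite. *)
Definition min_cost_to_go (R : realType) (nx : nat) (S : safe_set R nx)
    (x : 'rV[R]_nx) : \bar R :=
  ereal_inf [set J%:E | J in [set J | exists i, S (i, x, J)]].

Definition worst_risk (R : realType) (nx nu nw : nat) (p : mpc_data R nx nu nw)
    (D : set (probability (borelRn R nw) R)) (x : 'rV[R]_nx) : \bar R :=
  ereal_sup [set cvar (risk_level p) mu (noises p) (risk_fun p x) | mu in D].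

(* Only the values xs 0, ..., xs K and us 0, ..., us (K - 1) matter. *)
Definition FH_feasible (R : realType) (nx nu nw : nat) (p : mpc_data R nx nu nw)
    (S : safe_set R nx) (D : set (probability (borelRn R nw) R)) (x : 'rV[R]_nx)
    (xs : nat -> 'rV[R]_nx) (us : nat -> 'rV[R]_nu) : Prop :=
  [/\ xs 0%N = x,
      forall k, (k < horizon p)%N ->
        [/\ xs k.+1 = dyn p (xs k) (us k), states p (xs k), inputs p (us k) &
            (worst_risk p D (xs k) <= (risk_bound p)%:E)%E] &
      Pi_state S (xs (horizon p))].

Definition FH_cost (R : realType) (nx nu nw : nat) (p : mpc_data R nx nu nw)
    (S : safe_set R nx) (xs : nat -> 'rV[R]_nx) (us : nat -> 'rV[R]_nu) : \bar R :=
  ((\sum_(k < horizon p) stage_cost p (xs k) (us k))%:E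
   + min_cost_to_go S (xs (horizon p)))%E.

Definition FH_value (R : realType) (nx nu nw : nat) (p : mpc_data R nx nu nw)
    (S : safe_set R nx) (D : set (probability (borelRn R nw) R))
    (x : 'rV[R]_nx) : \bar R :=
  ereal_inf [set c | exists xs us,
    FH_feasible p S D x xs us /\ c = FH_cost p S xs us].

Definition FH_optimal (R : realType) (nx nu nw : nat) (p : mpc_data R nx nu nw)
    (S : safe_set R nx) (D : set (probability (borelRn R nw) R)) (x : 'rV[R]_nx)
    (xs : nat -> 'rV[R]_nx) (us : nat -> 'rV[R]_nu) : Prop :=
  FH_feasible p S D x xs us /\
  forall xs' us', FH_feasible p S D x xs' us' ->
    (FH_cost p S xs us <= FH_cost p S xs' us')%E.

(* The states of X at which the finite-horizon problem has a finite value, that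
   is, on which FH_value is a function into [0, +oo[. *)
Definition FH_domain (R : realType) (nx nu nw : nat) (p : mpc_data R nx nu nw)
    (S : safe_set R nx) (D : set (probability (borelRn R nw) R)) : set 'rV[R]_nx :=
  [set x | states p x /\ (0 <= FH_value p S D x < +oo)%E].

(* Trajectories are indexed by all of nat: from time T on, the state stays at the
   target under zero input. *)
Definition rests_from (R : realType) (nx nu nw : nat) (p : mpc_data R nx nu nw)
    (x : nat -> 'rV[R]_nx) (u : nat -> 'rV[R]_nu) (T : nat) : Prop :=
  forall t, (T <= t)%N -> x t = target p /\ u t = 0.

Definition DR_MPC (R : realType) (nx nu nw : nat) (p : mpc_data R nx nu nw)
    (S : safe_set R nx) (D : set (probability (borelRn R nw) R))
    (x : nat -> 'rV[R]_nx) (u : nat -> 'rV[R]_nu) (T : nat) : Prop :=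
  [/\ x 0%N = start p,
      forall t, (t < T)%N ->
        [/\ x t <> target p,
            exists xs us, FH_optimal p S D (x t) xs us /\ u t = us 0%N &
            x t.+1 = dyn p (x t) (u t)] &
      rests_from p x u T].

Definition cost_to_go (R : realType) (nx nu nw : nat) (p : mpc_data R nx nu nw)
    (x : nat -> 'rV[R]_nx) (u : nat -> 'rV[R]_nu) (t : nat) : R :=
  limn (fun n => \sum_(t <= k < n) stage_cost p (x k) (u k)).

Definition augment (R : realType) (nx nu nw : nat) (p : mpc_data R nx nu nw)
    (S : safe_set R nx) (j : nat) (x : nat -> 'rV[R]_nx) (u : nat -> 'rV[R]_nu)
    (T : nat) : safe_set R nx :=
  S `|` [set (j, x t, cost_to_go p x u t) | t in [set t | (1 <= t <= T)%N]].

Definition prune (R : realType) (nx nu nw : nat) (p : mpc_data R nx nu nw)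
    (D : set (probability (borelRn R nw) R)) (S : safe_set R nx) : safe_set R nx :=
  [set z | S z /\ ~ exists x J,
     S (z.1.1, x, J) /\ ((risk_bound p)%:E < worst_risk p D x)%E].

(* Data at the end of iteration j: m0 initial samples and, for 1 <= i <= j, one
   sample for each of the T i time steps of iteration i, drawn in order from the
   stream w. *)
Definition dataset (A : Type) (w : nat -> A) (m0 : nat) (T : nat -> nat)
    (j : nat) : seq A :=
  mkseq w (m0 + \sum_(1 <= i < j.+1) T i).

(* The first n iterations; x j, u j, T j are the states, inputs and length of the
   trajectory of iteration j >= 1, while S j and D j are the safe set and the
   ambiguity set at the end of iteration j. *)
Definition iterative_MPC (R : realType) (nx nu nw : nat) (p : mpc_data R nx nu nw)
    (D : nat -> set (probability (borelRn R nw) R)) (S : nat -> safe_set R nx)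
    (x : nat -> nat -> 'rV[R]_nx) (u : nat -> nat -> 'rV[R]_nu) (T : nat -> nat)
    (n : nat) : Prop :=
  forall j, (1 <= j <= n)%N ->
    DR_MPC p (S j.-1) (D j.-1) (x j) (u j) (T j) /\
    S j = prune p (D j) (augment p (S j.-1) j (x j) (u j) (T j)).

Definition safe_initialization (R : realType) (nx nu nw : nat)
    (p : mpc_data R nx nu nw) (S0 : safe_set R nx) : Prop :=
  [/\ sampled_safe_set p S0,
      (exists x u T,
        [/\ x 0%N = start p,
            forall t, (t < T)%N -> inputs p (u t) /\ x t.+1 = dyn p (x t) (u t),
            rests_from p x u T &
            forall t, (t <= T)%N -> S0 (0%N, x t, cost_to_go p x u t)]) &
      forall x, Pi_state S0 x ->
        states p x /\ forall w, noises p w -> risk_fun p x w <= risk_bound p].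

(* X_e, for e = gamma and e = c *)
Definition near_target (R : realType) (nx nu nw : nat) (p : mpc_data R nx nu nw)
    (e : R) : set 'rV[R]_nx :=
  [set x | states p x /\ enorm (x - target p) <= e].

(* f may leave X, so r_x is a function on the whole space. *)
Definition Qset (R : realType) (nx nu nw : nat) (p : mpc_data R nx nu nw)
    (rx : 'rV[R]_nx -> R) (ru : 'rV[R]_nu -> R) (gamma : R) : set 'rV[R]_nx :=
  [set x | near_target p gamma x /\
     exists u1, [/\ inputs p u1, dyn p x u1 = target p &
       forall u, inputs p u -> rx (dyn p x u) + ru u >= ru u1]].

(* Main.v *)
Require Import Defs.
From HB Require Import structures.
From mathcomp Require Import all_boot all_order all_algebra.
From mathcomp Require Import all_classical all_reals all_analysis.

Set Implicit Arguments.
Unset Strict Implicit.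
Unset Printing Implicit Defensive.

Import Order.TTheory GRing.Theory Num.Theory.
Import numFieldNormedType.Exports.

Local Open Scope classical_set_scope.
Local Open Scope ring_scope.

(** Write x_F for the target. The value function J is nonnegative
    ([FH_value_ge0]) and vanishes at x_F, so continuity there amounts to an upper
    bound on J that tends to 0 along the states where J is finite.

    The initial trajectory is robustly safe, hence its states satisfy the risk
    constraint for every ambiguity set ([worst_risk_le_of_robust]), and pruning
    never removes it ([iterative_MPC_invariant]). Thus the triple with state x_F
    and cost-to-go 0 lies in every safe set, and x_F meets the risk constraint:
    resting at x_F is a feasible plan of cost 0.

    Let y be close to x_F with J(y) finite. Some plan starting at y is feasible,
    so y itself meets the risk constraint. Closeness puts y in the set Q, which
    provides an input v with f(y, v) = x_F. Moving to x_F by v and resting there is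
    feasible, so J(y) <= r_x(y) + r_u(v) ([FH_value_le_one_step]). Comparing v
    with the input 0 in the inequality that defines Q gives
    r_u(v) <= r_x(f(y, 0)), and therefore
      0 <= J(y) <= r_x(y) + r_x(f(y, 0)).
    Both terms on the right tend to r_x(x_F) = 0, by continuity of r_x and of f on
    Q x U. *)

Section SafeSets.
Context {R : realType} {nx nu nw : nat}.
Implicit Types (p : mpc_data R nx nu nw) (x : 'rV[R]_nx).
Implicit Types (S : safe_set R nx) (D : set (probability (borelRn R nw) R)).

(** The choice s = b in the infimum makes the excess over s vanish. *)
Lemma cvar_le_of_bounded d (T : measurableType d) (beta b : R)
    (mu : probability T R) (A : set T) (Z : T -> R) :
  (forall w, A w -> Z w <= b) -> (cvar beta mu A Z <= b%:E)%E.
Proof.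
move=> Zb; apply: ereal_inf_lbound; exists b => //.
rewrite integral0_eq ?mule0 ?adde0// => w Aw.
by congr EFin; apply/max_idPr; rewrite subr_le0 Zb.
Qed.

Lemma worst_risk_le_of_robust p D x :
  (forall w, noises p w -> risk_fun p x w <= risk_bound p) ->
  (worst_risk p D x <= (risk_bound p)%:E)%E.
Proof.
by move=> safe; apply: ge_ereal_sup => _ [mu _ <-]; exact: cvar_le_of_bounded.
Qed.

(** Once the system rests at the target, the partial sums are constant. *)
Lemma cost_to_go_finite_sum p (xs : nat -> 'rV[R]_nx) (us : nat -> 'rV[R]_nu)
    (T t : nat) :
  stage_cost p (target p) 0 = 0 -> rests_from p xs us T -> (t <= T)%N ->
  cost_to_go p xs us t = \sum_(t <= k < T) stage_cost p (xs k) (us k).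
Proof.
move=> r0 rest tT; apply: lim_near_cst => //; near=> n.
have Tn : (T <= n)%N by near: n; exists T.
rewrite (big_cat_nat tT Tn)/= [X in _ + X]big_nat_cond.
rewrite [X in _ + X]big1 ?addr0// => k /andP[/andP[Tk _] _].
by have [-> ->] := rest _ Tk.
Unshelve. all: by end_near. Qed.

Lemma min_cost_to_go_ge0 p S x :
  sampled_safe_set p S -> (0 <= min_cost_to_go S x)%E.
Proof.
move=> safeS; apply: le_ereal_inf_tmp => _ [J [i SJ] <-].
by rewrite lee_fin; have [] := safeS _ _ _ SJ.
Qed.

Lemma FH_value_ge0 p S D x :
  (forall y v, states p y -> inputs p v -> 0 <= stage_cost p y v) ->
  sampled_safe_set p S -> (0 <= FH_value p S D x)%E.
Proof.
move=> r_ge0 safeS; apply: le_ereal_inf_tmp => _ [xs [us [[_ feas _] ->]]].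
apply: adde_ge0; last exact: min_cost_to_go_ge0 safeS.
by rewrite lee_fin sumr_ge0// => k _; have [_ Xk Uk _] := feas k (ltn_ord k);
  exact: r_ge0.
Qed.

(** The plan that moves x to the target by v and rests there until the end of the
    horizon is feasible and costs only its first step. *)
Lemma FH_value_le_one_step p S D x (v : 'rV[R]_nu) (i : nat) :
  (0 < horizon p)%N -> states p (target p) -> inputs p 0 ->
  dyn p (target p) 0 = target p -> stage_cost p (target p) 0 = 0 ->
  (worst_risk p D (target p) <= (risk_bound p)%:E)%E ->
  S (i, target p, 0) ->
  states p x -> inputs p v -> (worst_risk p D x <= (risk_bound p)%:E)%E ->
  dyn p x v = target p ->
  (FH_value p S D x <= (stage_cost p x v)%:E)%E.
Proof.
move=> K_gt0 XF U0 eqF r0 riskF SF Xx Uv riskx xvF.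
pose xs k := if k is 0%N then x else target p.
pose us k : 'rV[R]_nu := if k is 0%N then v else 0.
have xsK : xs (horizon p) = target p by move: K_gt0; case: (horizon p).
apply: (@le_trans _ _ (FH_cost p S xs us)).
  apply: ereal_inf_lbound; exists xs, us; split; last by [].
  split; [by []|by case=> [|k] _; split|].
  by rewrite xsK; exists i, 0.
rewrite /FH_cost xsK -[leRHS]adde0; apply: leeD.
  rewrite lee_fin; move: K_gt0; case: (horizon p) => // n _.
  by rewrite big_ord_recl/= big1 ?addr0.
by apply: ereal_inf_lbound; exists 0 => //; exists i.
Qed.

Lemma FH_value_lty_feasible p S D x :
  (FH_value p S D x < +oo)%E -> exists xs us, FH_feasible p S D x xs us.
Proof.
by move=> /ereal_inf_lt[_ [xs [us [feas _]]] _]; exists xs, us.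
Qed.

(** Before the target is reached, state and input open a feasible plan, whose
    constraints at step 0 apply because the horizon is positive. *)
Lemma DR_MPC_admissible p S D (xs : nat -> 'rV[R]_nx) (us : nat -> 'rV[R]_nu)
    (T t : nat) :
  (0 < horizon p)%N -> states p (target p) -> inputs p 0 ->
  DR_MPC p S D xs us T -> states p (xs t) /\ inputs p (us t).
Proof.
move=> K_gt0 XF U0 [_ run rest]; have [Tt|tT] := leqP T t.
  by have [-> ->] := rest _ Tt.
have [_ [ys [vs [[[y0 feas _] _] ->]]] _] := run _ tT.
by have [_ + + _] := feas 0%N K_gt0; rewrite y0.
Qed.

Lemma augment_sampled_safe_set p S D (j : nat) (xs : nat -> 'rV[R]_nx)
    (us : nat -> 'rV[R]_nu) (T : nat) :
  (0 < horizon p)%N -> states p (target p) -> inputs p 0 ->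
  stage_cost p (target p) 0 = 0 ->
  (forall y v, states p y -> inputs p v -> 0 <= stage_cost p y v) ->
  DR_MPC p S D xs us T -> sampled_safe_set p S ->
  sampled_safe_set p (augment p S j xs us T).
Proof.
move=> K_gt0 XF U0 r0 r_ge0 run safeS i y J [/safeS//|[t /andP[_ tT] [_ <- <-]]].
have adm k := DR_MPC_admissible k K_gt0 XF U0 run.
split; first by have [] := adm t.
have [_ _ rest] := run; rewrite (cost_to_go_finite_sum r0 rest tT).
by apply: sumr_ge0 => k _; have [] := adm k; exact: r_ge0.
Qed.

(** Index 0 is never given to a new trajectory, so the triples carrying it remain
    those of the initial safe set; these are safe for every noise value, hence
    for every ambiguity set, and pruning keeps them. *)
Lemma iterative_MPC_invariant p (D : nat -> set (probability (borelRn R nw) R))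
    (S : nat -> safe_set R nx) (x : nat -> nat -> 'rV[R]_nx)
    (u : nat -> nat -> 'rV[R]_nu) (T : nat -> nat) (n : nat) :
  (0 < horizon p)%N -> states p (target p) -> inputs p 0 ->
  stage_cost p (target p) 0 = 0 ->
  (forall y v, states p y -> inputs p v -> 0 <= stage_cost p y v) ->
  safe_initialization p (S 0%N) -> iterative_MPC p D S x u T n ->
  sampled_safe_set p (S n) /\
  forall y J, S n (0%N, y, J) <-> S 0%N (0%N, y, J).
Proof.
move=> K_gt0 XF U0 r0 r_ge0 [safe0 _ robust].
elim: n => [//|n IHn] iter.
have [safen idx0] : sampled_safe_set p (S n) /\
    forall y J, S n (0%N, y, J) <-> S 0%N (0%N, y, J).
  by apply: IHn => i /andP[i1 ik]; apply: iter; rewrite i1 ltnW.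
have /iter[/= run ->] : (1 <= n.+1 <= n.+1)%N by rewrite /= leqnn.
split.
  move=> i y J [+ _]; exact: (augment_sampled_safe_set K_gt0 XF U0 r0 r_ge0 run).
have aug0 y J : augment p (S n) n.+1 (x n.+1) (u n.+1) (T n.+1) (0%N, y, J) <->
    S 0%N (0%N, y, J).
  by rewrite -idx0; split=> [[//|[t _ [//]]]|]; left.
move=> y J; split=> [[/aug0]//|S0yJ]; split; first exact/aug0.
move=> [z [J' [/aug0 S0z]]]; apply/negP; rewrite -leNgt.
by apply: worst_risk_le_of_robust; apply: (robust z _).2; exists 0%N, J'.
Qed.

End SafeSets.

Lemma enorm_continuous (R : realType) (n : nat) :
  continuous (@enorm R n).
Proof.
move=> v; rewrite /enorm.
apply: (@continuous_comp _ _ _ (fun w : 'rV[R]_n => \sum_i w ord0 i ^+ 2)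
  Num.sqrt); last exact: sqrt_continuous.
apply: continuous_big => [|i _ w]; first exact: add_continuous.
apply: (@continuous_comp _ _ _ (fun w : 'rV[R]_n => w ord0 i)
  (fun t => t ^+ 2)); [exact: coord_continuous|exact: exprn_continuous].
Qed.

Lemma enorm0 (R : realType) (n : nat) : enorm (0 : 'rV[R]_n) = 0.
Proof.
by rewrite /enorm big1 ?sqrtr0// => i _; rewrite mxE expr0n.
Qed.

Lemma near_near_target (R : realType) (nx nu nw : nat) (p : mpc_data R nx nu nw)
    (e : R) : 0 < e ->
  \forall y \near target p, enorm (y - target p) <= e.
Proof.
move=> e_gt0.
have sub0 : y - target p @[y --> target p] --> (0 : 'rV[R]_nx).
  rewrite -[X in _ --> X](subrr (target p)).
  exact: (cvgB cvg_id (cvg_cst (target p))).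
have cv : enorm (y - target p) @[y --> target p] --> enorm (0 : 'rV[R]_nx).
  exact: (cvg_comp _ _ sub0 (@enorm_continuous R nx 0)).
by apply: (cvgr_le _ cv); rewrite enorm0.
Qed.

Theorem mainTheorem7 (R : realType) (nx nu nw : nat) (p : mpc_data R nx nu nw)
    (* problem data *)
    (Xcompact : compact (states p)) (Ucompact : compact (inputs p))
    (xS_X : states p (start p)) (xF_X : states p (target p))
    (U0 : inputs p 0) (xF_equilibrium : dyn p (target p) 0 = target p)
    (r_ge0 : forall x u, states p x -> inputs p u -> 0 <= stage_cost p x u)
    (Wcompact : compact (noises p : set 'rV[R]_nw))
    (gcont : {within states p `*` (noises p : set 'rV[R]_nw),
                continuous (fun z => risk_fun p z.1 z.2)})
    (delta_gt0 : 0 < risk_bound p)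
    (beta01 : 0 < risk_level p < 1)
    (K_ge1 : (1 <= horizon p)%N)
    (* uncertainty, i.i.d. samples and ambiguity sets *)
    (P : probability (borelRn R nw) R) (P_supp : P (noises p) = 1%E)
    (d : measure_display) (Omega : measurableType d) (Pr : probability Omega R)
    (xi : nat -> {RV Pr >-> borelRn R nw}) (xi_iid : iid P xi)
    (xi_W : forall k om, noises p (xi k om))
    (zeta : R) (zeta01 : 0 < zeta < 1)
    (DD : seq (borelRn R nw) -> set (probability (borelRn R nw) R))
    (DD_ambiguity : ambiguity_map P xi (noises p) zeta DD)
    (* 1-step reachability and the stage cost *)
    (gamma : R) (gamma_gt0 : 0 < gamma)
    (reach1 : forall x, near_target p gamma x ->
       exists2 u1, inputs p u1 & dyn p x u1 = target p)
    (rx : 'rV[R]_nx -> R) (ru : 'rV[R]_nu -> R)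
    (rE : forall x u, states p x -> inputs p u -> stage_cost p x u = rx x + ru u)
    (rx_cont : continuous rx) (ru_cont : {within inputs p, continuous ru})
    (rx_xF : rx (target p) = 0)
    (rx_gt0 : forall x, states p x -> x <> target p -> 0 < rx x)
    (ru_0 : ru 0 = 0)
    (ru_gt0 : forall u, inputs p u -> u <> 0 -> 0 < ru u)
    (hyp_i : exists2 c : R, 0 < c & near_target p c `<=` Qset p rx ru gamma)
    (hyp_ii : exists2 rK : R -> R, class_K rK &
       forall x, states p x -> ~ Qset p rx ru gamma x ->
         rK (enorm (x - target p)) <= rx x)
    (f_cont : {within Qset p rx ru gamma `*` inputs p,
                 continuous (fun z => dyn p z.1 z.2)})
    (* a run of the procedure, for a given outcome of the sampling *)
    (om : Omega) (m0 : nat) (S : nat -> safe_set R nx)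
    (x : nat -> nat -> 'rV[R]_nx) (u : nat -> nat -> 'rV[R]_nu) (T : nat -> nat)
    (S0_init : safe_initialization p (S 0%N))
    (j : nat) (j_ge1 : (1 <= j)%N) :
  let D i := DD (dataset (fun k => xi k om) m0 T i) in
  iterative_MPC p D S x u T j ->
  let J := FH_value p (S j) (D j) in
  let dom := FH_domain p (S j) (D j) in
  dom (target p) /\
  fine (J y) @[y --> within dom (nbhs (target p))] --> fine (J (target p)).
Proof.
move=> D iter J dom.
have r0 : stage_cost p (target p) 0 = 0 by rewrite rE// rx_xF ru_0 addr0.
have [safeS idx0] :=
  iterative_MPC_invariant K_ge1 xF_X U0 r0 r_ge0 S0_init iter.
have [_ [x0 [u0 [T0 [_ _ rest0 S0x0]]]] robust] := S0_init.
have S0F : S 0%N (0%N, target p, 0).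
  have := S0x0 T0 (leqnn _).
  by rewrite (cost_to_go_finite_sum r0 rest0)// big_geq// (rest0 _ (leqnn _)).1.
have SF : S j (0%N, target p, 0) by exact/idx0.
have riskF : (worst_risk p (D j) (target p) <= (risk_bound p)%:E)%E.
  by apply: worst_risk_le_of_robust; apply: (robust _ _).2; exists 0%N, 0.
have J_ge0 y : (0 <= J y)%E by exact: FH_value_ge0.
have J_le y v := @FH_value_le_one_step _ _ _ _ p (S j) (D j) y v _
  K_ge1 xF_X U0 xF_equilibrium r0 riskF SF.
have JF : J (target p) = 0%E.
  by apply/le_anti; rewrite J_ge0 andbT -[leRHS]/(0%:E) -r0 J_le.
split; first by split=> //; rewrite -/(J _) JF lexx ltry.
rewrite JF /=.
have [c c_gt0 cQ] := hyp_i.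
have nearQ : \forall y \near target p, states p y -> Qset p rx ru gamma y.
  near=> y => Xy; apply: cQ; split=> //.
  by near: y; exact: near_near_target.
have QF : Qset p rx ru gamma (target p) by exact: nbhs_singleton nearQ xF_X.
(* In the inequality defining Q, comparing with the zero input bounds the input
   cost of the one-step move. *)
have bound : \forall y \near within dom (nbhs (target p)),
    0 <= fine (J y) <= rx y + rx (dyn p y 0).
  move: nearQ; rewrite near_withinE; apply: filterS => y Qy [Xy /andP[_ Jy]].
  rewrite fine_ge0//=.
  have [_ [v [Uv yvF /(_ 0 U0)]]] := Qy Xy; rewrite ru_0 addr0 => ruv.
  have [ys [vs [y0 feas _]]] := FH_value_lty_feasible Jy.
  have [_ _ _] := feas 0%N K_ge1; rewrite y0 => risky.
  have Jyv := J_le _ v Xy Uv risky yvF.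
  rewrite -lee_fin fineK ?ge0_fin_numE//; apply: (le_trans Jyv).
  by rewrite rE// lee_fin lerD2l.
have dynF : dyn p y 0 @[y --> within dom (nbhs (target p))] --> target p.
  have : dyn p z.1 z.2 @[z --> within (Qset p rx ru gamma `*` inputs p)
      (nbhs (target p, 0 : 'rV[R]_nu))] --> target p.
    rewrite -[X in _ --> X]xF_equilibrium.
    by have /subspace_continuousP/(_ (target p, 0) (conj QF U0)) := f_cont.
  apply: (@cvg_comp _ _ _ (fun y => (y, 0)) (fun z => dyn p z.1 z.2)).
  (* Pairing with the input 0 stays in Q x U near the target, since the domain of
     the value function lies in X. *)
  move=> A /= [[A1 A2] [/= A1n A2n] A12].
  suff : \forall y \near target p, dom y -> A (y, 0) by [].
  apply: filterS2 nearQ A1n => y Qy A1y [Xy _].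
  apply: (A12 (y, 0)) => //=; first by split=> //=; exact: nbhs_singleton A2n.
  by split=> //=; exact: Qy.
apply: (squeeze_cvgr bound); first exact: cvg_cst.
rewrite -[X in _ --> X](addr0 0) -rx_xF.
apply: cvgD.
  by apply: cvg_within_filter; exact: rx_cont.
by apply: cvg_comp dynF _; exact: rx_cont.
Unshelve. all: by end_near. Qed.
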